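(* Let $C_1:f_1=0$ and $C_2:f_2=0$ be two reduced curves in $\mathbb{P}^2$ (over $\mathbb{C}$) with no irreducible component in common. Then the union curve $C=C_1\cup C_2: f=f_1\cdot f_2=0$ satisfies $$t(C)\leq \min\{t(C_1)+\deg(C_2),\ t(C_2)+\deg(C_1)\}.$$
   Context: Let $S=\mathbb{C}[x,y,z]$ with its standard grading. For a reduced curve $C:f=0$ of degree $d$ in $\mathbb{P}^2=\mathbb{P}^2_{\mathbb{C}}$, let $$D_0(f)=\{(a,b,c)\in S^3 : af_x+bf_y+cf_z=0\}$$ be the graded $S$-module of Jacobian syzygies, where a homogeneous element $(a,b,c)$ has degree $k$ if $a,b,c$ are homogeneous of degree $k$. Let $d_1\leq d_2\leq\dots\leq d_m$ be the degrees of the elements of a minimal system of homogeneous generators of $D_0(f)$. The type of $C$ is the integer $t(C)=d_1+d_2+1-d$. *)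

(* Defs.v *)
From HB Require Import structures.
From mathcomp Require Import all_boot all_order all_algebra.
From mathcomp Require Import reals complex mpoly.

Set Implicit Arguments.
Unset Strict Implicit.
Unset Printing Implicit Defensive.

Import GRing.Theory.

Local Open Scope ring_scope.

Section PlaneCurves.

Variable R : realType.

Local Notation S := {mpoly (complex R)[3]}.

Definition poly_divides (g f : S) : Prop := exists h : S, f = h * g.

Definition irreducible_mpoly (p : S) : Prop :=
  [/\ p != 0, p \isn't a GRing.unit &
      forall a b : S, p = a * b -> a \is a GRing.unit \/ b \is a GRing.unit].

Definition squarefree_mpoly (f : S) : Prop :=
  forall g : S, poly_divides (g ^+ 2) f -> g \is a GRing.unit.

(* [f = 0] is a reduced curve of degree [d] in P^2; [0] is [d.-homog] for every
   [d], and constants define no curve, so both are excluded explicitly. *)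
Definition reduced_curve (d : nat) (f : S) : Prop :=
  [/\ (0 < d)%N, f != 0, f \is d.-homog & squarefree_mpoly f].

(* Irreducible factors of a homogeneous polynomial are homogeneous, so these are
   exactly the equations of the irreducible components of the curve [f = 0]. *)
Definition irreducible_component (p f : S) : Prop :=
  irreducible_mpoly p /\ poly_divides p f.

Definition no_common_component (f1 f2 : S) : Prop :=
  ~ exists p : S, irreducible_component p f1 /\ irreducible_component p f2.

(* [v] in S^3 is a row vector (a, b, c); [f^`M(i)] is the i-th partial
   derivative of [f]. *)
Definition D0 (f : S) (v : 'rV[S]_3) : Prop :=
  \sum_(i < 3) v 0 i * f^`M(i) = 0.

Definition homogeneous_vector (k : nat) (v : 'rV[S]_3) : Prop :=
  forall i : 'I_3, v 0 i \is k.-homog.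

Definition generates (M : 'rV[S]_3 -> Prop) (m : nat) (g : 'I_m -> 'rV[S]_3)
    (A : {set 'I_m}) : Prop :=
  (forall i, i \in A -> M (g i)) /\
  (forall v, M v -> exists c : 'I_m -> S, v = \sum_(i in A) c i *: g i).

Definition minimal_generators (M : 'rV[S]_3 -> Prop) (m : nat)
    (g : 'I_m -> 'rV[S]_3) : Prop :=
  generates M g [set: 'I_m] /\
  (forall A : {set 'I_m}, A \proper [set: 'I_m] -> ~ generates M g A).

(* [ds] is the nondecreasing list d_1 <= ... <= d_m of the degrees of a minimal
   system of homogeneous generators of [D0 f]. *)
Definition syzygy_degrees (f : S) (ds : seq nat) : Prop :=
  sorted leq ds /\
  exists g : 'I_(size ds) -> 'rV[S]_3,
    minimal_generators (D0 f) g /\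
    (forall i : 'I_(size ds), homogeneous_vector (nth 0%N ds i) (g i)).

(* [t] is the type of the curve [f = 0] of degree [d].  It is a relation because
   the list of degrees is only specified through a choice of generators; it
   does not depend on that choice. *)
Definition curve_type (d : nat) (f : S) (t : int) : Prop :=
  exists (d1 d2 : nat) (ds : seq nat),
    syzygy_degrees f [:: d1, d2 & ds] /\
    t = d1%:Z + d2%:Z + 1 - d%:Z.

End PlaneCurves.

(* Main.v *)
Require Import Defs.
From HB Require Import structures.
From mathcomp Require Import all_boot all_order all_algebra.
From mathcomp Require Import reals complex mpoly.
From mathcomp Require Import boolp ring zify.

(** Write E = (x, y, z) for the Euler field and v(f) = a f_x + b f_y + c f_z for
    v = (a, b, c); Euler's identity is E(f) = (deg f) f for homogeneous f.

    A syzygy v of f1 (so v(f1) = 0) gives a syzygy of f1 f2, namely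
      v~ = (e1 + e2) f2 v - v(f2) E,
    because (e1 + e2) f2 f1 v(f2) - v(f2) (e1 + e2) f1 f2 = 0
    ([lift_syzygyP]).  If v is homogeneous of degree k, then v~ is homogeneous of
    degree k + e2.  The map v |-> v~ is linear, and injective on D0(f1): if
    v~ = 0, applying both sides to f1 gives v(f2) e1 f1 = 0, hence v(f2) = 0 and
    then v = 0.  So it preserves linear independence.

    Apply it to the first two minimal generators g1, g2 of D0(f1), of degrees
    d1 <= d2.  The result is two independent homogeneous syzygies of f1 f2, of
    degrees d1 + e2 and d2 + e2.  If h1, h2, ... are minimal generators of
    D0(f1 f2), of degrees d1' <= d2' <= ..., a nonzero homogeneous syzygy has
    degree at least d1', and one of degree less than d2' is a multiple of h1; two
    multiples of h1 are dependent.  Hence d1' <= d1 + e2 and d2' <= d2 + e2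
    ([independent_degree_bound]), and
      t(C) = d1' + d2' + 1 - (e1 + e2) <= (d1 + d2 + 1 - e1) + e2 = t(C1) + e2.
    The other bound follows by exchanging the two curves.

    What remains is that g1 and g2 are linearly independent
    ([irredundant_independent]), and this is where unique factorization in
    C[x,y,z] enters.  If a g1 = b g2 with a nonzero, cancelling common factors
    writes g1 = c u and g2 = d u for a single vector u, which is again in D0(f1)
    as S is a domain.  Expand u on the generators: by minimality the coefficient
    of g2 in g2 = d u has constant term 1 (graded Nakayama), so d(0) is nonzero.
    Now d g1 = c g2, and its component of degree d1 expresses d(0) g1 as a
    multiple of g2, against the minimality of the generators.

    Unique factorization is proved for polynomial rings in any number of
    variables over a field by Gauss's lemma and induction on the number of
    variables, through the isomorphism of K[x_0,...,x_n] with
    K[x_0,...,x_{n-1}][x_n]. *)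

Set Implicit Arguments.
Unset Strict Implicit.
Unset Printing Implicit Defensive.

Import Order.TTheory GRing.Theory Num.Theory.

Local Open Scope ring_scope.

(** * Divisibility and factorial domains *)

Definition divides (R : comNzRingType) (a b : R) : Prop := exists c, b = c * a.

Section Divides.
Variable R : comNzRingType.
Implicit Types a b c : R.

Lemma divides0 a : divides a 0.
Proof. by exists 0; rewrite mul0r. Qed.

Lemma divides_mulr a b c : divides a b -> divides a (b * c).
Proof. by case=> d ->; exists (d * c); rewrite mulrAC. Qed.

Lemma divides_mull a b c : divides a b -> divides a (c * b).
Proof. by case=> d ->; exists (c * d); rewrite mulrA. Qed.

Lemma dividesD a b c : divides a b -> divides a c -> divides a (b + c).
Proof. by case=> d -> [e ->]; exists (d + e); rewrite mulrDl. Qed.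

Lemma dividesB a b c : divides a (b + c) -> divides a b -> divides a c.
Proof. by case=> d e [k ek]; exists (d - k); rewrite mulrBl -e -ek addrC addKr. Qed.

Lemma divides_polyC (c : R) (f : {poly R}) :
  divides c%:P f <-> forall i, divides c f`_i.
Proof.
split=> [[g ->] i|h].
  by rewrite mulrC coefCM; exists g`_i; rewrite mulrC.
have [k ek] := choice h.
exists (\poly_(i < size f) k i); apply/polyP => i.
rewrite mulrC coefCM coef_poly; case: ltnP => [_|le]; first by rewrite ek mulrC.
by rewrite mulr0 nth_default.
Qed.

Lemma divides_mulX (c : R) (f : {poly R}) : divides c%:P (f * 'X) -> divides c%:P f.
Proof.
move/divides_polyC=> h; apply/divides_polyC => i.
by have := h i.+1; rewrite coefMX.
Qed.

End Divides.

Section Factorial.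
Variable R : idomainType.
Implicit Types (a b p : R).

Definition irreducible_elt p : Prop :=
  [/\ p != 0, p \isn't a GRing.unit &
      forall a b, p = a * b -> a \is a GRing.unit \/ b \is a GRing.unit].

Definition euclid_property p : Prop :=
  forall a b, divides p (a * b) -> divides p a \/ divides p b.

(** An additive size vanishing on units only; it makes factorization into
    irreducibles terminate, so that no chain condition has to be stated. *)
Definition length_function (len : R -> nat) : Prop :=
  (forall a b, a != 0 -> b != 0 -> len (a * b) = (len a + len b)%N) /\
  (forall a, a != 0 -> len a = 0%N -> a \is a GRing.unit).

(** Unique factorization: irreducible factorizations exist by the first half and
    are unique by the second. *)
Definition factorial_domain : Prop :=
  (exists len, length_function len) /\
  (forall p, irreducible_elt p -> euclid_property p).

Lemma length_nonunit len a : length_function len -> a != 0 ->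
  a \isn't a GRing.unit -> (0 < len a)%N.
Proof.
by case=> _ hu a0; apply: contraR; rewrite -eqn0Ngt => /eqP; apply: hu.
Qed.

Lemma irreducible_factor len a : length_function len -> a != 0 ->
  a \isn't a GRing.unit -> exists p b, irreducible_elt p /\ a = p * b.
Proof.
move=> hl; have [n] := ubnP (len a); elim: n a => // n IH a lta a0 aU.
have [irr|nirr] := EM (irreducible_elt a).
  by exists a, 1; rewrite mulr1.
have [b [c [e bU cU]]] : exists b c,
    [/\ a = b * c, b \isn't a GRing.unit & c \isn't a GRing.unit].
  apply: contrapT => h; apply: nirr; split=> // b c e.
  have [bU|bU] := boolP (b \is a GRing.unit); first by left.
  have [cU|cU] := boolP (c \is a GRing.unit); first by right.
  by case: h; exists b, c.
move: a0; rewrite e mulf_eq0 negb_or => /andP[b0 c0].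
have lc := length_nonunit hl c0 cU.
have lb : (len b < n)%N.
  move: lta; rewrite e (proj1 hl) // ltnS; apply: leq_trans.
  by rewrite -addn1 leq_add2l.
have [p [d [ip eb]]] := IH b lb b0 bU.
by exists p, (d * c); rewrite eb mulrA.
Qed.

(** Induction on the number of irreducible factors. *)
Lemma factor_ind (P : R -> Prop) : factorial_domain ->
  (forall u, u \is a GRing.unit -> P u) ->
  (forall p a, irreducible_elt p -> euclid_property p -> a != 0 -> P a -> P (p * a)) ->
  forall a, a != 0 -> P a.
Proof.
case=> [[len hl] he] hu hp a; have [n] := ubnP (len a).
elim: n a => // n IH a lta a0.
have [/hu//|aU] := boolP (a \is a GRing.unit).
have [p [b [ip e]]] := irreducible_factor hl a0 aU.
move: a0; rewrite e mulf_eq0 negb_or => /andP[p0 b0].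
apply: hp => //; first exact: he.
have [_ pU _] := ip; have lp := length_nonunit hl p0 pU.
apply: IH => //; move: lta; rewrite e (proj1 hl) // ltnS; apply: leq_trans.
by rewrite -addn1 addnC leq_add2r.
Qed.

(** Cancel the irreducible factors p of a one at a time: by Euclid's property p
    divides b, or else it divides all the entries of w, and then w / p is used
    instead of w. *)
Lemma proportional_common_factor n (a b : R) (v w : 'rV[R]_n) :
  factorial_domain -> a != 0 -> a *: v = b *: w ->
  exists (u : 'rV[R]_n) c d, v = c *: u /\ w = d *: u.
Proof.
move=> fR a0; move: a a0 b v w.
apply: (factor_ind fR) => [a aU|p a ip ep a0 IH] b v w e.
  exists w, (a^-1 * b), 1; rewrite scale1r; split=> //.
  by rewrite -scalerA -e scalerA mulVr ?scale1r.
have [p0 _ _] := ip.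
have cancel_p (x y : 'rV[R]_n) : p *: x = p *: y -> x = y.
  move=> exy; apply/rowP => i; apply: (mulfI p0).
  by have := congr1 (fun z : 'rV_n => z 0 i) exy; rewrite !mxE.
have [[b' eb]|pb] := EM (divides p b).
  apply: (IH b'); apply: cancel_p.
  by rewrite !scalerA [p * b']mulrC -eb.
have /choice[k ek] : forall i, divides p (w 0 i).
  move=> i; have [] : divides p b \/ divides p (w 0 i) => //.
  apply: ep; exists (a * v 0 i).
  have := congr1 (fun z : 'rV_n => z 0 i) e; rewrite !mxE => <-.
  by rewrite -mulrA mulrC.
have ew : w = p *: \row_i k i by apply/rowP => i; rewrite !mxE ek mulrC.
have [|u [c [d [ev ek']]]] := IH b v (\row_i k i).
  by apply: cancel_p; rewrite scalerA e ew !scalerA mulrC.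
by exists u, c, (p * d); rewrite -scalerA -ek'.
Qed.

End Factorial.

(** * Gauss's lemma *)

Section Gauss.
Variable R : idomainType.
Implicit Types (f g p q : {poly R}) (c : R).

(** An element with Euclid's property in R keeps it in R[X].  Look at constant
    terms x, y of the two factors: c divides x y, hence x, say; then c divides
    the product with the first factor replaced by f, of smaller degree. *)
Lemma euclid_polyC c : euclid_property c -> euclid_property c%:P.
Proof.
move=> hc; elim/poly_ind => [|f x IHf] g; first by left; exact: divides0.
elim/poly_ind: g => [|g y IHg] h; first by right; exact: divides0.
have : divides c (x * y).
  move/divides_polyC/(_ 0%N): h.
  by rewrite coef0M !coefD !coefMX !coefC !eqxx !add0r.
case/hc=> hx.
  have hx' : divides c%:P x%:P by case: hx => k ->; exists k%:P; rewrite polyCM.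
  have : divides c%:P (f * (g * 'X + y%:P)).
    apply: divides_mulX; rewrite mulrAC; move: h; rewrite mulrDl addrC => h.
    by apply: (dividesB h); apply: divides_mulr.
  case/IHf => hf; [left|by right].
  by apply: dividesD hx'; apply: divides_mulr.
have hy : divides c%:P y%:P by case: hx => k ->; exists k%:P; rewrite polyCM.
have /IHg[hf|hg] : divides c%:P ((f * 'X + x%:P) * g).
  apply: divides_mulX; rewrite -mulrA; move: h; rewrite mulrDr addrC => h.
  by apply: (dividesB h); apply: divides_mull.
- by left.
- by right; apply: dividesD hy; apply: divides_mulr.
Qed.

Definition primitive f : Prop := forall c, divides c%:P f -> c \is a GRing.unit.

Hypothesis fR : factorial_domain R.

(** Extract nonunit constant factors; each one shortens the leading
    coefficient. *)
Lemma primitive_part f : f != 0 -> exists c g, primitive g /\ f = c%:P * g.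
Proof.
have [[len hl] _] := fR.
have [n] := ubnP (len (lead_coef f)); elim: n f => // n IH f ltf f0.
have [prf|] := EM (primitive f); first by exists 1, f; rewrite mul1r.
rewrite /primitive => /existsNP[c /not_implyP[[g e] /negP cU]].
move: (f0); rewrite e mulf_eq0 negb_or => /andP[g0 c0].
rewrite polyC_eq0 in c0.
have lc := length_nonunit hl c0 cU.
have [|//|d [h [ph eg]]] := IH g.
  move: ltf; rewrite e lead_coefM lead_coefC (proj1 hl) ?lead_coef_eq0 // ltnS.
  by apply: leq_trans; rewrite -addn1 leq_add2l.
by exists (c * d), h; split=> //; rewrite eg polyCM mulrC mulrA.
Qed.

(** Gauss's lemma: the irreducible factors of c stay prime in R[X] and none of
    them divides f, so each can be removed from g. *)
Lemma gauss_primitive f c g : primitive f -> c != 0 ->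
  divides c%:P (f * g) -> divides c%:P g.
Proof.
move=> pf c0; move: c c0 g; apply: (factor_ind fR) => [u uU|p a ip ep a0 IH] g.
  by exists (g * u^-1%:P); rewrite -mulrA -polyCM mulVr ?mulr1.
have [p0 pU _] := ip.
case=> h e.
have /(euclid_polyC ep)[/pf|[g' eg]] : divides p%:P (f * g).
  by exists (h * a%:P); rewrite e polyCM mulrA mulrAC.
  by move=> pU'; rewrite pU' in pU.
have [|k ek] := IH g'.
  exists h; apply: (@mulIf _ p%:P); first by rewrite polyC_eq0.
  by rewrite -mulrA -eg e polyCM mulrAC mulrA.
by exists k; rewrite eg ek polyCM mulrAC mulrA.
Qed.

Lemma irreducible_primitive p : irreducible_elt p -> (1 < size p)%N -> primitive p.
Proof.
case=> p0 pU hp sp c [h e].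
case: (hp _ _ e) => [|]; rewrite poly_unitE; last first.
  by rewrite coefC eqxx => /andP[].
case/andP=> /size_poly1P[d d0 eh] _.
by move: sp; rewrite e eh -polyCM size_polyC; case: (_ != 0).
Qed.

Lemma min_size_elt (I : {poly R} -> Prop) f : I f -> f != 0 ->
  exists2 h, I h /\ h != 0 & forall g, I g -> (size g < size h)%N -> g = 0.
Proof.
move=> If f0.
pose P n := `[< exists h, [/\ I h, h != 0 & size h = n] >].
have exP : exists n, P n by exists (size f); apply/asboolP; exists f.
case: (ex_minnP exP) => n /asboolP[h [Ih h0 sh]] hmin.
exists h => // g Ig; rewrite sh ltnNge => lt; apply/eqP; apply: contraNT lt => g0.
by apply: hmin; apply/asboolP; exists g.
Qed.

(** If p divides a b, take a nonzero h of least degree in the ideal (p, a).  By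
    pseudo-division h divides, up to constants, all the elements of the ideal, so
    by Gauss's lemma its primitive part h1 divides p and a.  As p is irreducible,
    either h1 is associate to p, which then divides a, or h1 is a unit and h is a
    constant c up to a unit; in that case p divides h b, so c b, and p being
    primitive divides b. *)
Lemma primitive_irreducible_euclid p :
  irreducible_elt p -> primitive p -> euclid_property p.
Proof.
move=> ip pp a b [w ew]; have [p0 pU hp] := ip.
pose I x := exists u v, x = u * p + v * a.
have [h [[u [v eh]] h0] hmin] : exists2 h, I h /\ h != 0 &
    forall g, I g -> (size g < size h)%N -> g = 0.
  by apply: (@min_size_elt I p) => //; exists 1, 0; rewrite mul1r mul0r addr0.
have [c [h1 [ph1 ech]]] := primitive_part h0.
have c0 : c != 0.
  by apply: contraNneq h0 => c0; rewrite ech c0 mul0r.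
have dvdI x : I x -> divides h1 x.
  move=> [s [t ex]].
  have e := Pdiv.Idomain.divp_eq x h.
  have r0 : Pdiv.IdomainDefs.modp x h = 0.
    apply: hmin; last by rewrite Pdiv.Idomain.ltn_modp.
    set k := lead_coef h ^+ _ in e; set q := Pdiv.IdomainDefs.divp x h in e.
    exists (k%:P * s - q * u), (k%:P * t - q * v).
    have -> : Pdiv.IdomainDefs.modp x h = k%:P * x - q * h.
      by rewrite mul_polyC e addrC addKr.
    by rewrite eh ex; ring.
  move: e; rewrite r0 addr0 -mul_polyC ech => e.
  set l := lead_coef _ ^+ _ in e; set q := Pdiv.IdomainDefs.divp _ _ in e.
  have l0 : l != 0 by exact: Pdiv.Idomain.lc_expn_scalp_neq0.
  have [|y ey] := @gauss_primitive h1 l (c%:P * q) ph1 l0.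
    by exists x; rewrite mulrC [RHS]mulrC e; ring.
  exists y; apply: (@mulfI _ l%:P); first by rewrite polyC_eq0.
  by rewrite mulrA [_ * y]mulrC -ey e; ring.
have [t et] : divides h1 p by apply: dvdI; exists 1, 0; rewrite mul1r mul0r addr0.
have [s es] : divides h1 a by apply: dvdI; exists 0, 1; rewrite mul1r mul0r add0r.
case: (hp _ _ et) => [tU|h1U].
  by left; exists (s * t^-1); rewrite es et -mulrA mulKr.
right.
have : divides c%:P (p * (u * b + v * w)).
  exists (h1 * b); rewrite mulrAC [h1 * _]mulrC -ech eh mulrC.
  have : (u * p + v * a) * b = p * (u * b) + v * (a * b) by ring.
  by rewrite ew => ->; ring.
case/(gauss_primitive pp c0) => k ek.
exists (h1^-1 * k); apply: (mulrI h1U); rewrite -mulrA mulVKr //.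
apply: (@mulfI _ c%:P); first by rewrite polyC_eq0.
rewrite mulrA -ech eh [RHS]mulrA [c%:P * k]mulrC -ek.
have -> : (u * p + v * a) * b = u * p * b + v * (a * b) by ring.
by rewrite ew; ring.
Qed.

(** Units of R[X] are the unit constants, so both the degree and the leading
    coefficient have to be measured. *)
Lemma poly_length (len : R -> nat) : length_function len ->
  length_function (fun f : {poly R} => (size f).-1 + len (lead_coef f))%N.
Proof.
case=> hM hU; split=> [f g f0 g0|f f0].
  rewrite lead_coefM hM ?lead_coef_eq0 // size_mul //.
  rewrite (polySpred f0) (polySpred g0) addSn addnS /=.
  by rewrite addnACA.
move/eqP; rewrite addn_eq0 => /andP[/eqP s0 /eqP l0].
have s1 : size f = 1 by rewrite (polySpred f0) s0.
rewrite poly_unitE s1 eqxx /=.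
have := hU (lead_coef f); rewrite lead_coef_eq0 => /(_ f0 l0).
by rewrite lead_coefE s1.
Qed.

Lemma irreducible_polyC c : irreducible_elt c%:P -> irreducible_elt c.
Proof.
have cU (a : R) : (a%:P \is a GRing.unit) = (a \is a GRing.unit).
  by rewrite poly_unitE coefC eqxx size_polyC; have [->|] := eqVneq a 0; rewrite ?unitr0.
case=> c0 U h; split; first by rewrite -polyC_eq0.
  by rewrite -cU.
by move=> a b e; rewrite -!cU; apply: h; rewrite e polyCM.
Qed.

Lemma factorial_poly : factorial_domain {poly R}.
Proof.
have [[len hl] he] := fR; split; first by eexists; exact: (poly_length hl).
move=> p ip; have [sp|sp] := leqP (size p) 1.
  move: ip; rewrite (size1_polyC sp) => ip.
  by apply/euclid_polyC/he/irreducible_polyC.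
exact/primitive_irreducible_euclid/irreducible_primitive.
Qed.

End Gauss.

(** * Polynomial rings over a field are factorial *)

Lemma factorial_iso (A B : idomainType) (f : {rmorphism A -> B}) (g : B -> A) :
  cancel f g -> cancel g f -> factorial_domain B -> factorial_domain A.
Proof.
move=> fK gK [[len [hM hU]] he].
have f_inj := can_inj fK.
have f0 a : (f a == 0) = (a == 0) by rewrite -(rmorph0 f) (inj_eq f_inj).
have fU a : (f a \is a GRing.unit) = (a \is a GRing.unit).
  apply/idP/idP => [/unitrP[y [_ y1]]|]; last exact: rmorph_unit.
  apply/unitrP; exists (g y); split; apply: f_inj; rewrite rmorphM gK rmorph1 //.
  by rewrite mulrC.
have fdvd a b : divides (f a) (f b) <-> divides a b.
  split=> [[y e]|[y ->]]; last by exists (f y); rewrite rmorphM.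
  by exists (g y); apply: f_inj; rewrite rmorphM gK.
split.
  exists (len \o f); split=> [a b a0 b0|a a0 l0] /=.
    by rewrite rmorphM hM ?f0.
  by rewrite -fU; apply: hU; rewrite ?f0.
move=> p [p0 pU hp] a b /fdvd; rewrite rmorphM => h.
rewrite -!fdvd; apply: he h; split; rewrite ?f0 ?fU //.
move=> x y; rewrite -[x]gK -[y]gK -rmorphM => /f_inj/hp.
by rewrite !fU.
Qed.

Section MUni.
Variables (n : nat) (K : comNzRingType).

(** Evaluate at the last variable: the inverse of [muni], which sees a polynomial
    in n + 1 variables as one in the last variable. *)
Definition muni_inv (q : {poly {mpoly K[n]}}) : {mpoly K[n.+1]} :=
  (map_poly (@mwiden n K) q).['X_ord_max].

Lemma muniK : cancel (@muni n K) muni_inv.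
Proof.
move=> p; rewrite muniE /muni_inv raddf_sum /= horner_sum [RHS]mpolyE.
apply: eq_bigr => m _; rewrite map_polyZ map_polyXn hornerZ hornerXn /=.
rewrite mwidenZ mwidenX -scalerAl mpolyXn -mpolyXD; congr (_ *: 'X_[_]).
apply/mnmP => j; rewrite mnmDE mulmnE mnm1E.
have [i ->|->] := unliftP ord_max j; last first.
  by rewrite mnmwiden_ordmax eqxx mul1n.
have -> : lift ord_max i = widen_ord (leqnSn n) i by apply: val_inj; exact: lift_max.
rewrite mnmwiden_widen mnmE -val_eqE /= gtn_eqF ?ltn_ord // mul0n addn0.
by congr (m _); apply: val_inj.
Qed.

Lemma muniX (m : 'X_{1..n.+1}) :
  muni ('X_[m] : {mpoly K[n.+1]}) =
  'X_[[multinom (m (widen_ord (leqnSn n) i)) | i < n]] *: 'X^(m ord_max).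
Proof. by rewrite muniE msuppX big_seq1 mcoeffX eqxx scale1r. Qed.

Lemma muni_mwiden (c : {mpoly K[n]}) : muni (mwiden c) = c%:P.
Proof.
rewrite {1}[c]mpolyE (raddf_sum (@mwiden n K)) (raddf_sum (@muni n K)) /=.
rewrite [in RHS](mpolyE c) (raddf_sum (@polyC {mpoly K[n]})) /=.
apply: eq_bigr => m _; rewrite mwidenZ mwidenX muniZ muniX mnmwiden_ordmax.
rewrite expr0 scalerA alg_polyC mul_mpolyC; congr (_ *: 'X_[_])%:P.
by apply/mnmP => i; rewrite mnmE mnmwiden_widen.
Qed.

Lemma muni_ord_max : muni ('X_ord_max : {mpoly K[n.+1]}) = 'X.
Proof.
rewrite muniX mnm1E eqxx; have -> : [multinom (U_(ord_max) (widen_ord (leqnSn n) i))%MM | i < n] = 0%MM.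
  by apply/mnmP => i; rewrite !mnmE -val_eqE /= gtn_eqF // ltn_ord.
by rewrite mpolyX0 scale1r expr1.
Qed.

Lemma muni_invK : cancel muni_inv (@muni n K).
Proof.
elim/poly_ind => [|q c IH]; rewrite /muni_inv; first by rewrite raddf0 horner0 muni0.
rewrite rmorphD rmorphM /= map_polyX map_polyC hornerD hornerM hornerX hornerC.
by rewrite muniD muniM muni_ord_max muni_mwiden -[X in muni X * _]/(muni_inv q) IH.
Qed.

End MUni.

Lemma factorial_mpoly (K : fieldType) n : factorial_domain {mpoly K[n]}.
Proof.
elim: n => [|n IH].
  have U (p : {mpoly K[0]}) : p != 0 -> p \is a GRing.unit.
    rewrite (nvar0_mpolyC p) mpolyC_eq0 => p0; apply/unitrP.
    by exists (p@_0)^-1%:MP; rewrite -!mpolyCM mulVf ?mulfV.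
  split; last by move=> p [/U ->].
  by exists (fun=> 0%N); split=> // a /U.
exact: (factorial_iso (@muniK n K) (@muni_invK n K) (factorial_poly IH)).
Qed.

(** * Homogeneous components *)

Section Homogeneous.
Variables (n : nat) (K : fieldType).
Implicit Types (c p f : {mpoly K[n]}).

Lemma pihomog_mul_homog c p d e : p \is e.-homog ->
  pihomog mdeg d (c * p) =
  (if (e <= d)%N then pihomog mdeg (d - e) c else 0) * p.
Proof.
move=> hp; rewrite [c]mpolyE mulr_suml raddf_sum /=.
have -> : (if (e <= d)%N then pihomog mdeg (d - e)
    (\sum_(m <- msupp c) c@_m *: 'X_[m]) else 0) =
    \sum_(m <- msupp c) c@_m *: (if (mdeg m + e)%N == d then 'X_[m] else 0).
  case: leqP => led; last first.
    rewrite big1 // => m _; rewrite gtn_eqF ?scaler0 //.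
    by rewrite (leq_trans led) ?leq_addl.
  rewrite raddf_sum; apply: eq_bigr => m _ /=.
  by rewrite linearZ /= pihomogX -(eqn_add2r e) subnK.
rewrite mulr_suml; apply: eq_bigr => m _.
rewrite -!scalerAl linearZ /=; congr (_ *: _).
have hm : 'X_[m] * p \is (mdeg m + e).-homog by apply: dhomogM; rewrite ?dhomogX.
case: eqP => [<-|/eqP ne]; first by rewrite pihomog_dE.
by rewrite mul0r (pihomog_ne0 ne hm).
Qed.

Lemma pihomog_deg0 c : pihomog mdeg 0 c = (c@_0%MM)%:MP.
Proof.
rewrite [in LHS](mpolyE c) raddf_sum /= -[in RHS]alg_mpolyC.
have [h|h] := boolP (0%MM \in msupp c); last first.
  rewrite (memN_msupp_eq0 h) scale0r big_seq big1 // => m hm.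
  rewrite linearZ /= pihomogX mdeg_eq0; case: eqP => [em|]; rewrite ?scaler0 //.
  by rewrite em (negbTE h) in hm.
rewrite (bigD1_seq 0%MM) ?msupp_uniq //= linearZ /= pihomogX mdeg_eq0 eqxx mpolyX0.
rewrite big1 ?addr0 // => m hm.
by rewrite linearZ /= pihomogX mdeg_eq0 (negbTE hm) scaler0.
Qed.

Lemma dhomog_mderiv d f i : f \is d.-homog -> f^`M(i) \is d.-1.-homog.
Proof.
move=> hf; rewrite [f]mpolyE raddf_sum /= big_seq; apply: rpred_sum => m hm.
rewrite linearZ /= mderivX; apply: dhomogZ.
have [->|mi] := posnP (m i); first by rewrite scale0r dhomog0.
apply: dhomogZ; rewrite dhomogX.
have <- := dhomog_mf hf hm.
have e : (m = (m - U_(i)) + U_(i))%MM by rewrite submK // lep1mP -lt0n.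
by rewrite [in X in _ == X]e /= mdegD mdeg1 addn1.
Qed.

(** On a monomial, x_i d/dx_i multiplies by the exponent of x_i, and the
    exponents add up to the degree. *)
Lemma euler_identity d f : f \is d.-homog ->
  \sum_(i < n) 'X_i * f^`M(i) = d%:R * f.
Proof.
move=> hf.
under eq_bigr => i _ do rewrite {1}[f]mpolyE raddf_sum mulr_sumr.
rewrite exchange_big /= [in RHS](mpolyE f) mulr_sumr big_seq [RHS]big_seq.
apply: eq_bigr => m hm.
rewrite -(dhomog_mf hf hm) /= mdegE natr_sum mulr_suml; apply: eq_bigr => i _.
rewrite linearZ /= mderivX -!scalerAr.
have [->|mi] := posnP (m i); first by rewrite scale0r mul0r.
have e : (m = U_(i) + (m - U_(i)))%MM by rewrite addmC submK // lep1mP -lt0n.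
by rewrite -mpolyXD -e scaler_nat mulr_natl.
Qed.

End Homogeneous.

(** * Minimal homogeneous generators *)

Section Generators.
Variables (n r : nat) (K : fieldType).
Local Notation S := {mpoly K[n]}.
Implicit Types (v w u : 'rV[S]_r) (M : 'rV[S]_r -> Prop).

Definition homog_row k v : Prop := forall i, v 0 i \is k.-homog.

(** The degree k component of a linear relation between homogeneous vectors.  The
    truncated subtractions k - l and k - deg j occur only under the tests that
    make them exact: a vector of degree above k contributes nothing. *)
Lemma homog_scaled_sum (J : finType) (P : pred J) (deg : J -> nat)
    (g : J -> 'rV[S]_r) (c : J -> S) k l a v :
  (forall j, homog_row (deg j) (g j)) -> homog_row l v ->
  a *: v = \sum_(j | P j) c j *: g j ->
  (if (l <= k)%N then pihomog mdeg (k - l) a else 0) *: v = \sum_(j | P j)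
    (if (deg j <= k)%N then pihomog mdeg (k - deg j) (c j) else 0) *: g j.
Proof.
move=> hg hv e; apply/rowP => i.
have := congr1 (fun z : 'rV[S]_r => pihomog mdeg k (z 0 i)) e.
rewrite !summxE raddf_sum !mxE (pihomog_mul_homog _ _ (hv i)) => ->.
by apply: eq_bigr => j _; rewrite !mxE /= (pihomog_mul_homog _ _ (hg j i)).
Qed.

Lemma homog_sum (J : finType) (P : pred J) (deg : J -> nat)
    (g : J -> 'rV[S]_r) (c : J -> S) k v :
  (forall j, homog_row (deg j) (g j)) -> homog_row k v ->
  v = \sum_(j | P j) c j *: g j ->
  v = \sum_(j | P j)
    (if (deg j <= k)%N then pihomog mdeg (k - deg j) (c j) else 0) *: g j.
Proof.
move=> hg hv e; rewrite -(homog_scaled_sum (a := 1) k hg hv).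
  by rewrite leqnn subnn pihomog_deg0 mcoeff1 eqxx mpolyC1 scale1r.
by rewrite scale1r.
Qed.

(** Graded Nakayama: in degree deg i the relation reads
    (1 - c_i(0)) g_i = a combination of the other generators. *)
Lemma redundant_generator (J : finType) (deg : J -> nat) (g : J -> 'rV[S]_r)
    (c : J -> S) i :
  (forall j, homog_row (deg j) (g j)) ->
  g i = \sum_j c j *: g j -> (c i)@_0%MM != 1 ->
  forall a : J -> S, exists b : J -> S,
    \sum_j a j *: g j = \sum_(j | j != i) b j *: g j.
Proof.
move=> hg e ci1; have := homog_sum hg (hg i) e.
rewrite (bigD1 i) //= leqnn subnn pihomog_deg0.
set c' := fun j => if (deg j <= deg i)%N then pihomog mdeg (deg i - deg j) (c j) else 0.
move=> ei; pose s : S := (1 - (c i)@_0%MM)^-1%:MP.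
have gi : g i = s *: \sum_(j | j != i) c' j *: g j.
  have -> : \sum_(j | j != i) c' j *: g j = (1 - (c i)@_0%MM)%:MP *: g i.
    apply/esym/eqP; rewrite mpolyCB mpolyC1 scalerBl scale1r subr_eq addrC.
    exact/eqP.
  rewrite scalerA -mpolyCM mulVf ?mpolyC1 ?scale1r //.
  by rewrite subr_eq0 eq_sym.
move=> a; exists (fun j => a i * s * c' j + a j).
rewrite (bigD1 i) //= {1}gi scalerA scaler_sumr -big_split /=.
by apply: eq_bigr => j _; rewrite scalerDl scalerA.
Qed.

(** The form in which minimality of homogeneous generators is used. *)
Definition irredundant (J : finType) (g : J -> 'rV[S]_r) : Prop :=
  forall i (c : J -> S), g i = \sum_j c j *: g j -> (c i)@_0%MM = 1.

Section Irredundant.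
Variables (J : finType) (deg : J -> nat) (g : J -> 'rV[S]_r).
Hypotheses (g_irr : irredundant g) (hg : forall j, homog_row (deg j) (g j)).

Lemma generator_neq0 i : g i != 0.
Proof.
apply/eqP => gi; have /g_irr/eqP : g i = \sum_j (0 : S) *: g j.
  by rewrite gi big1 // => j _; rewrite scale0r.
by rewrite mcoeff0 eq_sym oner_eq0.
Qed.

Lemma generator_multiple_coef i a u :
  g i = a *: u -> (exists x : J -> S, u = \sum_j x j *: g j) -> a@_0%MM != 0.
Proof.
move=> gi [x ex].
have /g_irr h : g i = \sum_j (a * x j) *: g j.
  by rewrite {1}gi ex scaler_sumr; apply: eq_bigr => k _; rewrite scalerA.
apply: contraTneq (oner_neq0 K) => a0.
by rewrite -h rmorphM /= a0 mul0r eqxx.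
Qed.

(** The hypothesis on M says that it is saturated in S^r, as D0 f is.  For a
    module without this property the conclusion can fail: x and y are minimal
    generators of the ideal (x, y) but are dependent. *)
Lemma irredundant_independent M i j (a b : S) :
  (forall c u, c != 0 -> M (c *: u) -> M u) ->
  (forall k, M (g k)) -> (forall v, M v -> exists x : J -> S, v = \sum_k x k *: g k) ->
  i != j -> a *: g i = b *: g j -> a = 0 /\ b = 0.
Proof.
move=> sat Mg gen ij e.
have [a0|a0] := eqVneq a 0.
  split=> //; apply: contraNeq (generator_neq0 j) => b0.
  apply/eqP/rowP => l; apply: (mulfI b0).
  have := congr1 (fun z : 'rV[S]_r => z 0 l) e.
  by rewrite a0 !mxE mul0r mulr0.
exfalso.
have [u [c [d [ec ed]]]] := proportional_common_factor (@factorial_mpoly K n) a0 e.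
have c0 : c != 0.
  by apply: contraNneq (generator_neq0 i) => c0; rewrite ec c0 scale0r.
have Mu : M u by apply: (sat c) => //; rewrite -ec.
have d0 := generator_multiple_coef ed (gen u Mu).
(* Both sides are c d u; the one-term sum gives access to graded components. *)
have e2 : d *: g i = \sum_(k | k == j) c *: g k.
  by rewrite big_pred1_eq ec ed !scalerA mulrC.
have := homog_scaled_sum (deg i) hg (hg i) e2.
rewrite big_pred1_eq leqnn subnn pihomog_deg0.
set c' := if _ then _ else _ => e3.
have /g_irr : g i = \sum_k (if k == j then (d@_0%MM)^-1%:MP * c' else 0) *: g k.
  rewrite (bigD1 j) //= eqxx big1 ?addr0 => [|k /negbTE ->]; last first.
    by rewrite scale0r.
  by rewrite -scalerA -e3 scalerA -mpolyCM mulVf // mpolyC1 scale1r.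
by rewrite (negbTE ij) mcoeff0 => /eqP; rewrite eq_sym oner_eq0.
Qed.

End Irredundant.

(** Only generators of degree at most k can contribute to a homogeneous element of
    degree k. *)
Lemma low_degree_multiple (J : finType) (deg : J -> nat) (g : J -> 'rV[S]_r) i k v :
  (forall j, homog_row (deg j) (g j)) ->
  (forall j, j != i -> (k < deg j)%N) -> homog_row k v ->
  (exists c : J -> S, v = \sum_j c j *: g j) ->
  exists a, v = a *: g i /\ ((k < deg i)%N -> a = 0).
Proof.
move=> hg hk hv [c e].
exists (if (deg i <= k)%N then pihomog mdeg (k - deg i) (c i) else 0); split.
  rewrite {1}(homog_sum hg hv e) (bigD1 i) //= big1 ?addr0 //.
  by move=> j /hk; rewrite ltnNge => /negbTE ->; rewrite scale0r.
by rewrite ltnNge => /negbTE ->.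
Qed.

Definition independent v w : Prop :=
  forall a b : S, a *: v = b *: w -> a = 0 /\ b = 0.

Lemma independent_degree_bound d1 d2 ds k1 k2 v w
    (g : 'I_(size [:: d1, d2 & ds]) -> 'rV[S]_r) :
  sorted leq [:: d1, d2 & ds] ->
  (forall i : 'I_(size [:: d1, d2 & ds]), homog_row (nth 0%N [:: d1, d2 & ds] i) (g i)) ->
  (exists c, v = \sum_j c j *: g j) -> (exists c, w = \sum_j c j *: g j) ->
  independent v w -> (k1 <= k2)%N -> homog_row k1 v -> homog_row k2 w ->
  (d1 <= k1)%N /\ (d2 <= k2)%N.
Proof.
move=> srt hg Mv Mw ind k12 hv hw.
have d12 : (d1 <= d2)%N by case/andP: srt.
have dle (j : 'I_(size [:: d1, d2 & ds])) : j != ord0 ->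
    (d2 <= nth 0%N [:: d1, d2 & ds] j)%N.
  case: j => [[|j] jlt] // _; rewrite -[d2]/(nth 0%N [:: d1, d2 & ds] 1).
  by apply: (sorted_leq_nth leq_trans leqnn) => //; rewrite inE.
have v0 : v <> 0.
  move=> v0; have [|/eqP] := ind 1 0; first by rewrite v0 scaler0 scale0r.
  by rewrite oner_eq0.
have bound1 : (d1 <= k1)%N.
  rewrite leqNgt; apply/negP => lt.
  have [|a [e a0]] := low_degree_multiple (i := ord0) hg _ hv Mv.
    by move=> j /dle; apply: leq_trans; apply: leq_trans d12.
  by apply: v0; rewrite e a0 ?scale0r.
split=> //; rewrite leqNgt; apply/negP => lt.
have [|a [ea _]] := low_degree_multiple (i := ord0) hg _ hv Mv.
  by move=> j /dle; apply: leq_trans; apply: leq_ltn_trans lt.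
have [|b [eb _]] := low_degree_multiple (i := ord0) hg _ hw Mw.
  by move=> j /dle; apply: leq_trans.
have [|_ a0] := ind b a; first by rewrite ea eb !scalerA mulrC.
by apply: v0; rewrite ea a0 scale0r.
Qed.

End Generators.

(** * Lifting syzygies to the union of two curves *)

Section Curves.
Variable K : fieldType.
Local Notation S := {mpoly K[3]}.
Implicit Types (v w u : 'rV[S]_3).

Definition derivation v (f : S) : S := \sum_(i < 3) v 0 i * f^`M(i).

Definition euler_field : 'rV[S]_3 := \row_i 'X_i.

Lemma derivationZ a v f : derivation (a *: v) f = a * derivation v f.
Proof. by rewrite mulr_sumr; apply: eq_bigr => i _; rewrite mxE mulrA. Qed.

Lemma derivationB v w f : derivation (v - w) f = derivation v f - derivation w f.
Proof. by rewrite -sumrB; apply: eq_bigr => i _; rewrite !mxE mulrBl. Qed.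

Lemma derivationM v f g : derivation v (f * g) = derivation v f * g + f * derivation v g.
Proof.
rewrite mulr_suml mulr_sumr -big_split; apply: eq_bigr => i _ /=.
by rewrite mderivM; ring.
Qed.

Lemma derivation_euler d f : f \is d.-homog -> derivation euler_field f = d%:R * f.
Proof.
by move=> hf; rewrite -(euler_identity hf); apply: eq_bigr => i _; rewrite mxE.
Qed.

Lemma syzygy_saturated f c u :
  c != 0 -> derivation (c *: u) f = 0 -> derivation u f = 0.
Proof.
by rewrite derivationZ => c0 /eqP; rewrite mulf_eq0 (negbTE c0) => /eqP.
Qed.

Section Lift.
Variables (e1 e2 : nat) (f1 f2 : S).
Hypotheses (h1 : f1 \is e1.-homog) (h2 : f2 \is e2.-homog).
Hypothesis K_char0 : has_pchar0 K.
Hypotheses (e1_gt0 : (0 < e1)%N) (e2_gt0 : (0 < e2)%N) (f1_neq0 : f1 != 0) (f2_neq0 : f2 != 0).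

(** Correct f2 v by the multiple of the Euler field that makes it kill
    f1 f2. *)
Definition lift_syzygy v : 'rV[S]_3 :=
  ((e1 + e2)%:R * f2) *: v - derivation v f2 *: euler_field.

Lemma lift_syzygyP v : 
  derivation v f1 = 0 -> derivation (lift_syzygy v) (f1 * f2) = 0.
Proof.
move=> hv.
rewrite derivationB !derivationZ (derivation_euler (dhomogM h1 h2)) derivationM hv.
by ring.
Qed.

Lemma lift_syzygyB a b v w :
  lift_syzygy (a *: v - b *: w) = a *: lift_syzygy v - b *: lift_syzygy w.
Proof.
rewrite /lift_syzygy derivationB !derivationZ.
move: (derivation v f2) (derivation w f2) (_ * f2) => x y z.
rewrite !scalerBr scalerBl !scalerA [a * z]mulrC [b * z]mulrC.
by rewrite !opprB addrACA [RHS]addrACA; congr (_ + _); rewrite addrC.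
Qed.

Lemma lift_syzygy_homog k v :
  homog_row k v -> homog_row (k + e2) (lift_syzygy v).
Proof.
move=> hv i; rewrite !mxE; apply: rpredB.
  by rewrite mulr_natl mulrnAl rpredMn // addnC dhomogM.
(* The degree splits into k + (e2 - 1) for v(f2) and 1 for x_i. *)
have -> : (k + e2 = (k + e2.-1) + 1)%N by rewrite -addnA addn1 prednK.
apply: dhomogM; last by rewrite dhomogX /= mdeg1.
by apply: rpred_sum => j _; apply: dhomogM => //; apply: dhomog_mderiv.
Qed.

Lemma natr_mpoly_neq0 d : (0 < d)%N -> (d%:R : S) != 0.
Proof.
by move=> d0; rewrite -mpolyC_nat mpolyC_eq0 ((pcharf0P K).1 K_char0) -lt0n.
Qed.

(** Apply the relation (e1 + e2) f2 v = v(f2) E to f1: the left side vanishes and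
    E(f1) = e1 f1 does not, so v(f2) = 0. *)
Lemma lift_syzygy_inj v : derivation v f1 = 0 -> lift_syzygy v = 0 -> v = 0.
Proof.
move=> hv hl.
have := congr1 (fun z => derivation z f1) hl.
rewrite derivationB !derivationZ (derivation_euler h1) hv mulr0 sub0r.
have -> : derivation 0 f1 = 0 by apply: big1 => i _; rewrite mxE mul0r.
move/eqP; rewrite oppr_eq0 !mulf_eq0 (negbTE f1_neq0).
rewrite (negbTE (natr_mpoly_neq0 e1_gt0)) !orbF => /eqP hv2.
move: hl; rewrite /lift_syzygy hv2 scale0r subr0 => hl.
have c0 : (e1 + e2)%:R * f2 != 0.
  by rewrite mulf_neq0 // natr_mpoly_neq0 // addn_gt0 e1_gt0.
apply/rowP => i; apply: (mulfI c0); have := congr1 (fun z : 'rV_3 => z 0 i) hl.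
by rewrite !mxE mulr0.
Qed.

Lemma lift_syzygy_independent v w : derivation v f1 = 0 -> derivation w f1 = 0 ->
  independent v w -> independent (lift_syzygy v) (lift_syzygy w).
Proof.
move=> hv hw ind a b e; apply: ind; apply/eqP; rewrite -subr_eq0; apply/eqP.
apply: lift_syzygy_inj; last by rewrite lift_syzygyB e subrr.
by rewrite derivationB !derivationZ hv hw !mulr0 subr0.
Qed.

End Lift.
End Curves.

Section CurveType.
Variable R : realType.
Local Notation S := {mpoly (complex R)[3]}.

Lemma minimal_generatorsP (M : 'rV[S]_3 -> Prop) m (deg : 'I_m -> nat)
    (g : 'I_m -> 'rV[S]_3) :
  minimal_generators M g -> (forall i, homogeneous_vector (deg i) (g i)) ->
  [/\ forall i, M (g i),
      forall v, M v -> exists c : 'I_m -> S, v = \sum_i c i *: g i &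
      irredundant g].
Proof.
case=> [[Mg gen] minim] hg; have Mg' i : M (g i) by apply: Mg.
have gen' v : M v -> exists c : 'I_m -> S, v = \sum_i c i *: g i.
  by case/gen=> c ->; exists c; apply: eq_bigl => i; rewrite in_setT.
split=> // i c e; apply: contrapT => /eqP ci.
apply: (minim ([set: 'I_m] :\ i)); first by rewrite properD1.
split=> [j _|v /gen'[a ->]]; first exact: Mg'.
have [b eb] := redundant_generator hg e ci a.
by exists b; apply: (etrans eb); apply: eq_bigl => j; rewrite !inE andbT.
Qed.

Lemma type_union_le (e1 e2 : nat) (f1 f2 : S) (t1 t : int) :
  reduced_curve e1 f1 -> reduced_curve e2 f2 ->
  curve_type e1 f1 t1 -> curve_type (e1 + e2)%N (f1 * f2) t -> t <= t1 + e2%:Z.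
Proof.
move=> [e1_gt0 f1_neq0 h1 _] [e2_gt0 f2_neq0 h2 _].
move=> [d1 [d2 [ds [[srt [g [hmin hg]]] ->]]]].
move=> [d1' [d2' [ds' [[srt' [g' [hmin' hg']]] ->]]]].
have [Mg gen irr] := minimal_generatorsP hmin hg.
have [_ gen' _] := minimal_generatorsP hmin' hg'.
pose i0 : 'I_(size [:: d1, d2 & ds]) := ord0.
pose i1 : 'I_(size [:: d1, d2 & ds]) := lift ord0 ord0.
have ind : independent (g i0) (g i1).
  move=> a b; apply: (irredundant_independent irr hg _ Mg gen) => //.
  exact: syzygy_saturated.
have d12 : (d1 <= d2)%N by case/andP: srt.
have char0 : [pchar (complex R)] =i pred0 by apply: pchar_num.
have [] := independent_degree_bound srt' hg'
  (gen' _ (lift_syzygyP h1 h2 (Mg i0))) (gen' _ (lift_syzygyP h1 h2 (Mg i1)))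
  (lift_syzygy_independent h1 char0 e1_gt0 f1_neq0 f2_neq0 (Mg i0) (Mg i1) ind)
  (leq_add d12 (leqnn e2))
  (lift_syzygy_homog e1 h2 e2_gt0 (hg i0)) (lift_syzygy_homog e1 h2 e2_gt0 (hg i1)).
lia.
Qed.

End CurveType.

Theorem theorem1p4 (R : realType) (e1 e2 : nat) (f1 f2 : {mpoly (complex R)[3]})
    (hC1 : reduced_curve e1 f1) (hC2 : reduced_curve e2 f2)
    (hcomp : no_common_component f1 f2)
    (t1 t2 t : int)
    (ht1 : curve_type e1 f1 t1) (ht2 : curve_type e2 f2 t2)
    (ht : curve_type (e1 + e2)%N (f1 * f2) t) :
  t <= Num.min (t1 + e2%:Z) (t2 + e1%:Z).
Proof.
rewrite le_min (type_union_le hC1 hC2 ht1 ht) /=.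
by move: ht; rewrite addnC mulrC; exact: type_union_le.
Qed.
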